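(* Let $H$ be a simple hypergraph with $e$-index $k$, and let $\lambda_1(H)$ be the largest eigenvalue of its unified matrix $\mathbf{U}(H)$. Then $$\lambda_1(H)^2\leq\frac{k-1}{k}\left(\Big(\sum_{S\in I(H)} d_H(S)\Big)-\partial(H)\right).$$
   Context: A hypergraph $H$ consists of a finite non-empty vertex set $V(H)$ and a multiset $E(H)$ of non-empty subsets of $V(H)$, called edges. It is simple if it has no loops (edges of cardinality one) and no multiple edges. A 2-partition of a set $e$ is an unordered pair $\{S,S'\}$ of non-empty disjoint sets with $S\cup S'=e$; $S$ and $S'$ are called parts of $e$. $I(H)$ is the set of all parts of all edges of $H$ together with all singleton subsets of $V(H)$, and $k=|I(H)|$ is the $e$-index of $H$. For simple $H$, the unified matrix $\mathbf{U}(H)$ is the $k\times k$ matrix indexed by $I(H)$ whose $(S,S')$ entry is $1$ if $\{S,S'\}$ is a 2-partition of an edge of $H$, and $0$ otherwise. For $S\in I(H)$, the unified degree $d_H(S)$ is the number of edges $e\in E(H)$ (counted with multiplicity) with $S\subseteq e$. An edge $e$ is included if there is an edge $e'\ne e$ of $H$ with $e\subset e'$. $\partial(H)$ is the number (counted with multiplicity) of included edges of $H$ of cardinality at least $2$. *)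

(* Defs.v *)
From mathcomp Require Import all_boot all_order all_algebra.
From mathcomp Require Import finmap multiset reals polyrcf complex ring.

Set Implicit Arguments.
Unset Strict Implicit.
Unset Printing Implicit Defensive.

Import Order.TTheory GRing.Theory Num.Theory.
Local Open Scope ring_scope.

(* The vertex set is all of [V]; [edges e] is the multiplicity of [e]. *)
Record hypergraph (V : finType) := Hypergraph {
  edges : {mset {set V}}%mset;
  vertex_nonempty : (0 < #|V|)%N;
  edge_nonempty : forall e : {set V}, e \in edges -> e != set0 }.

Section Hypergraphs.
Variables (V : finType) (H : hypergraph V).
Implicit Types (e S T : {set V}).

Definition is_simple : Prop :=
  forall e, e \in edges H -> (#|e| != 1)%N /\ edges H e = 1%N.

(* Symmetric in [S] and [T], hence a predicate on unordered pairs. *)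
Definition two_partition e S T : bool :=
  [&& S != set0, T != set0, S :&: T == set0 & S :|: T == e].

Definition is_part e S : bool := [exists T, two_partition e S T].

Definition index_set : {set {set V}} :=
  [set S | [exists e, (e \in edges H) && is_part e S]]
  :|: [set [set x] | x : V].

Definition e_index : nat := #|index_set|.

Definition unified_matrix (R : pzRingType) : 'M[R]_e_index :=
  \matrix_(i, j)
    ([exists e, (e \in edges H)
       && two_partition e (enum_val i) (enum_val j)])%:R.

Definition unified_degree S : nat :=
  (\sum_(e : {set V} | S \subset e) edges H e)%N.

Definition included e : bool :=
  [exists e' : {set V}, [&& e' \in edges H, e' != e & e \subset e']].

Definition num_included : nat :=
  (\sum_(e : {set V} | included e && (2 <= #|e|)) edges H e)%N.

End Hypergraphs.

Definition largest_eigenvalue (R : realType) (n : nat) (A : 'M[R]_n) (l : R) :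
    Prop :=
  eigenvalue A l /\ forall a, eigenvalue A a -> a <= l.

(* [largest_eigenvalue] is satisfiable for every unified matrix: a real
   symmetric matrix of positive size has a largest real eigenvalue. *)
Section Existence.
Variable R : realType.

Let dot n (x y : 'rV[R]_n) : R := (x *m y^T) 0 0.

Let dotC n (x y : 'rV[R]_n) : dot x y = dot y x.
Proof. by rewrite /dot -[in LHS](trmxK x) -trmx_mul mxE. Qed.

Let dot_ge0 n (x : 'rV[R]_n) : 0 <= dot x x.
Proof. by rewrite /dot mxE sumr_ge0// => i _; rewrite mxE -expr2 sqr_ge0. Qed.

Let dot_eq0 n (x : 'rV[R]_n) : dot x x = 0 -> x = 0.
Proof.
rewrite /dot mxE => /eqP; rewrite psumr_eq0; last first.
  by move=> i _; rewrite mxE -expr2 sqr_ge0.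
move/allP => x0; apply/rowP => i; have := x0 i (mem_index_enum _).
by rewrite !mxE -expr2 sqrf_eq0 => /eqP.
Qed.

Lemma sym_eigenvalue_exists n (A : 'M[R]_n) :
  (0 < n)%N -> A^T = A -> exists a, eigenvalue A a.
Proof.
move=> n0 As; pose f := real_complex R.
have [l] : exists l : R[i], root (char_poly (map_mx f A)) l.
  apply/closed_rootP; rewrite size_char_poly; by case: n n0 {A As}.
rewrite -eigenvalue_root_char => /eigenvalueP[v vA v0].
case: l vA => a b vA.
pose x : 'rV[R]_n := map_mx (@complex.Re R) v.
pose y : 'rV[R]_n := map_mx (@complex.Im R) v.
have xA : x *m A = a *: x - b *: y.
  apply/rowP => i; move/rowP/(_ i)/(congr1 (@complex.Re R)) : vA.
  rewrite !mxE raddf_sum /= => vAi.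
  transitivity (complex.Re ((a +i* b)%C * v 0 i)); last by case: (v 0 i).
  rewrite -vAi; apply: eq_bigr => j _; rewrite !mxE.
  by case: (v 0 j) => p q /=; rewrite mulr0 subr0.
have yA : y *m A = b *: x + a *: y.
  apply/rowP => i; move/rowP/(_ i)/(congr1 (@complex.Im R)) : vA.
  rewrite !mxE raddf_sum /= => vAi.
  transitivity (complex.Im ((a +i* b)%C * v 0 i)); last first.
    by case: (v 0 i) => p q /=; rewrite addrC.
  rewrite -vAi; apply: eq_bigr => j _; rewrite !mxE.
  by case: (v 0 j) => p q /=; rewrite mulr0 add0r.
have AE : dot (x *m A) y = dot (y *m A) x.
  by rewrite dotC /dot trmx_mul As mulmxA.
have xy0 : x != 0 \/ y != 0.
  have [x0|] := eqVneq x 0; last by left.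
  right; apply: contra v0 => /eqP y0; apply/eqP/rowP => i.
  move/rowP: x0 => /(_ i); move/rowP: y0 => /(_ i); rewrite !mxE.
  by case: (v 0 i) => p q /= -> ->.
have : b * (dot x x + dot y y) = 0.
  move: AE; rewrite xA yA.
  have dotD c d (u w z : 'rV[R]_n) :
      dot (c *: u + d *: w) z = c * dot u z + d * dot w z.
    by rewrite /dot mulmxDl -!scalemxAl !mxE.
  rewrite -scaleNr !dotD (dotC y x) => E.
  by rewrite -(subrr (a * dot x y + - b * dot y y)) {1}E; ring.
move=> /eqP; rewrite mulf_eq0 => /orP[/eqP b0|]; last first.
  rewrite paddr_eq0// => /andP[/eqP/dot_eq0 x0 /eqP/dot_eq0 y0].
  by case: xy0; rewrite ?x0 ?y0 eqxx.
exists a; apply/eigenvalueP; case: xy0 => z0; [exists x|exists y] => //.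
  by rewrite xA b0 scale0r subr0.
by rewrite yA b0 scale0r add0r.
Qed.

Lemma largest_eigenvalue_exists n (A : 'M[R]_n) :
  (0 < n)%N -> A^T = A -> exists l, largest_eigenvalue A l.
Proof.
move=> n0 As; have [a Aa] := sym_eigenvalue_exists n0 As.
pose s := rootsR (char_poly A).
have sE b : (b \in s) = eigenvalue A b.
  rewrite eigenvalue_root_char; apply/esym.
  have := roots_on_rootsR (monic_neq0 (char_poly_monic A)) b.
  by rewrite inE /=.
exists (\big[Num.max/a]_(b <- s) b); split; last first.
  by move=> b; rewrite -sE => bs; apply: le_bigmax_seq.
rewrite big_seq; apply: (big_ind (eigenvalue A)) => //.
- by move=> b c Ab Ac; rewrite maxEle; case: ifP.
- by move=> b; rewrite sE.
Qed.

Lemma unified_matrix_largest_eigenvalue (V : finType) (H : hypergraph V) :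
  exists l, largest_eigenvalue (unified_matrix H R) l.
Proof.
apply: largest_eigenvalue_exists.
  have /card_gt0P[x _] := vertex_nonempty H.
  apply/card_gt0P; exists [set x]; rewrite inE; apply/orP; right.
  exact: imset_f.
apply/matrixP => i j; rewrite !mxE; congr (_%:R); congr (nat_of_bool _).
apply: eq_existsb => e; rewrite /two_partition setIC setUC.
by congr (_ && _); rewrite andbCA.
Qed.

End Existence.

(* Main.v *)
Require Import Defs.
From mathcomp Require Import finmap multiset.
From mathcomp Require Import all_boot all_order all_algebra reals ring.
Local Open Scope ring_scope.

Import Order.TTheory GRing.Theory Num.Theory.

(** Two facts give the bound.  A square matrix [A] of size [k] and trace [0] is
orthogonal to the identity for the Frobenius inner product, so an eigenvalue
[l] with unit eigenvector [v] is the inner product of [A] not only with the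
projector [v^T v] but also with [v^T v - 1/k], whose squared norm is
[1 - 1/k].  The Cauchy-Schwarz inequality then bounds [l ^+ 2] by
[(k - 1) / k] times the sum of the squared entries of [A]
([eigenvalue_sqr_le]).

The unified matrix has trace [0], because no edge splits into two disjoint
copies of one non-empty set, and its entries are [0] or [1], so the squared norm
counts its ones.  A one in row [S] is a complement [e :\: S] for an edge [e]
that strictly contains [S].  Hence the row sum is the unified degree of [S],
less one when [S] is itself an edge; and an edge belongs to the index set
exactly when it is included, loops being excluded ([edge_in_index_set]).
Summing over [S] gives the sum of the degrees minus the number of included
edges ([sum_unified_degree]). *)

(** * Eigenvalues of traceless matrices *)

(** Lagrange's identity: the difference of the two sides is half the sum of the
squares of the minors [a i * b j - a j * b i]. *)
Lemma sum_mul_sqr_le (R : realFieldType) (I : finType) (a b : I -> R) :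
  (\sum_i a i * b i) ^+ 2 <= (\sum_i a i ^+ 2) * (\sum_i b i ^+ 2).
Proof.
have : 0 <= \sum_i \sum_j (a i * b j - a j * b i) ^+ 2.
  by apply: sumr_ge0 => i _; apply: sumr_ge0 => j _; apply: sqr_ge0.
set X := \sum_i a i * b i; set P := \sum_i a i ^+ 2; set Q := \sum_i b i ^+ 2.
suff -> : \sum_i \sum_j (a i * b j - a j * b i) ^+ 2 = (P * Q - X ^+ 2) *+ 2.
  by rewrite pmulrn_lge0// subr_ge0.
transitivity (\sum_i (a i ^+ 2 * Q + b i ^+ 2 * P - (a i * b i * X) *+ 2)).
  apply: eq_bigr => i _; rewrite !mulr_sumr -sumrMnl -big_split/= -sumrB.
  by apply: eq_bigr => j _; ring.
by rewrite sumrB big_split/= sumrMnl -!mulr_suml -/P -/Q -/X; ring.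
Qed.

(** For an eigenvector [v] of squared norm [q], the Cauchy-Schwarz inequality is
applied to [A] and [W = v^T v - (q / n) 1]: their inner product is [l * q],
and the squared norm of [W] is [q ^+ 2 * (1 - 1 / n)]. *)
Lemma eigenvalue_sqr_le (R : realFieldType) (n : nat) (A : 'M[R]_n) (l : R) :
  \tr A = 0 -> eigenvalue A l ->
  l ^+ 2 <= (n%:R - 1) / n%:R * \sum_i \sum_j A i j ^+ 2.
Proof.
move=> trA /eigenvalueP[v vA v0].
pose q := \sum_i v 0 i ^+ 2.
have q0 : q != 0.
  apply: contra v0; rewrite psumr_eq0; last by move=> i _; apply: sqr_ge0.
  move=> /allP q0; apply/eqP/rowP => i; rewrite mxE; apply/eqP.
  by have := q0 i (mem_index_enum _); rewrite sqrf_eq0.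
have n0 : n%:R != 0 :> R.
  rewrite pnatr_eq0; apply: contra q0 => /eqP n0.
  by rewrite /q big1// => i; have := ltn_ord i; rewrite [X in (_ < X)%N]n0.
pose W i j := v 0 i * v 0 j - (q / n%:R) *+ (i == j).
have AW : \sum_i \sum_j A i j * W i j = l * q.
  transitivity (\sum_i (\sum_j v 0 i * A i j * v 0 j - A i i * (q / n%:R))).
    apply: eq_bigr => i _; rewrite [X in _ - X](_ : _ =
      \sum_j A i j * (q / n%:R) *+ (i == j)).
      by rewrite -sumrB; apply: eq_bigr => j _; rewrite /W -mulrnAr; ring.
    rewrite (bigD1 i)//= eqxx mulr1n big1 ?addr0// => j /negbTE ij.
    by rewrite eq_sym ij.
  rewrite sumrB -mulr_suml -/(\tr A) trA mul0r subr0 exchange_big/= mulr_sumr.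
  apply: eq_bigr => j _; rewrite -mulr_suml expr2 mulrA; congr (_ * _).
  by move/rowP: vA => /(_ j); rewrite !mxE.
have WW : \sum_i \sum_j W i j ^+ 2 = q ^+ 2 * ((n%:R - 1) / n%:R).
  transitivity (\sum_i (v 0 i ^+ 2 * q +
      ((q / n%:R) ^+ 2 - v 0 i ^+ 2 * (q / n%:R) *+ 2))).
    apply: eq_bigr => i _; rewrite [X in _ + X](_ : _ = \sum_j
      ((q / n%:R) ^+ 2 - v 0 i * v 0 j * (q / n%:R) *+ 2) *+ (i == j)).
      rewrite mulr_sumr -big_split/=; apply: eq_bigr => j _.
      by rewrite /W; case: (i == j); rewrite ?mulr1n ?mulr0n; ring.
    rewrite (bigD1 i)//= eqxx mulr1n -expr2 big1 ?addr0// => j /negbTE ij.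
    by rewrite eq_sym ij.
  rewrite big_split/= sumrB sumr_const card_ord sumrMnl -!mulr_suml -/q.
  by rewrite -mulr_natr; field.
have q2 : 0 < q ^+ 2 by rewrite exprn_even_gt0.
rewrite -(ler_pM2l q2) -exprMn [q * l]mulrC -AW mulrA -WW mulrC.
rewrite !pair_big/=.
exact: (sum_mul_sqr_le _ _ (fun p => A p.1 p.2) (fun p => W p.1 p.2)).
Qed.

(** * Counting the ones of the unified matrix *)

Section Counting.
Variables (V : finType) (H : hypergraph V).
Implicit Types (e S T : {set V}).

Lemma two_partition_proper e S T : two_partition e S T -> S \proper e.
Proof.
case/and4P=> _ /set0Pn[x xT] /eqP ST0 /eqP <-; rewrite properEneq subsetUl andbT.
apply/eqP => SE; have xS : x \in S by rewrite SE inE xT orbT.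
by have : x \in S :&: T; [rewrite inE xS | rewrite ST0 inE].
Qed.


Lemma two_partitionD {e S} : S != set0 -> S \proper e ->
  two_partition e S (e :\: S).
Proof.
move=> S0 Se; have sSe := proper_sub Se.
apply/and4P; split=> //.
- by rewrite setD_eq0; have := Se; rewrite properE => /andP[].
- by rewrite setIDA setIC -setIDA setDv setI0.
- by rewrite -{1}(setIidPr sSe) setID.
Qed.

Lemma two_partition_setD e S T : two_partition e S T -> T = e :\: S.
Proof.
case/and4P=> _ _ /eqP ST0 /eqP <-.
by rewrite setDUl setDv set0U; apply/esym/setDidPl; rewrite -setI_eq0 setIC ST0.
Qed.

Lemma two_partitionC e S T : two_partition e S T = two_partition e T S.
Proof. by rewrite /two_partition andbCA setIC setUC. Qed.

Lemma index_set_neq0 S : S \in index_set H -> S != set0.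
Proof.
rewrite !inE => /orP[/existsP[e /andP[_ /existsP[T /and4P[]]]]//|].
by move=> /imsetP[x _ ->]; rewrite -cards_eq0 cards1.
Qed.

Lemma part_in_index_set e S T :
  e \in edges H -> two_partition e S T -> S \in index_set H.
Proof.
move=> eH eST; rewrite !inE; apply/orP; left; apply/existsP; exists e.
by rewrite eH; apply/existsP; exists T.
Qed.

(** Row sum of the unified matrix: the ones in row [S] are at the complements of
[S] in the edges that strictly contain it, one for each such edge. *)
Lemma card_partners S : S != set0 ->
  #|[set T in index_set H | [exists e, (e \in edges H) && two_partition e S T]]|
  = #|[set e | (e \in edges H) && (S \proper e)]|.
Proof.
move=> S0; rewrite -(card_in_imset (f := fun e => e :\: S)); last first.
  move=> e f; rewrite !inE => /andP[_ Se] /andP[_ Sf] eq_ef.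
  by rewrite -(setID e S) -(setID f S) eq_ef !(setIidPr (proper_sub _)).
apply: eq_card => T; rewrite inE; apply/andP/imsetP => [[_]|].
  move=> /existsP[e /andP[eH eST]]; exists e; last exact: two_partition_setD eST.
  by rewrite inE eH (two_partition_proper _ _ _ eST).
case=> e; rewrite inE => /andP[eH /(two_partitionD S0) eS] ->; split.
  by apply: (part_in_index_set e _ S eH); rewrite two_partitionC.
by apply/existsP; exists e; rewrite eH.
Qed.

Hypothesis H_simple : is_simple H.

Lemma edges_simple e : edges H e = (e \in edges H).
Proof.
by case: (boolP (e \in edges H)) => [/H_simple[]|/mset_eq0P].
Qed.

(** An edge can enter the index set only as a part of another edge, since the
singletons are not edges; being a part of [f] means being a proper non-empty
subset of [f]. *)
Lemma edge_in_index_set e : e \in edges H ->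
  (e \in index_set H) = included H e && (2 <= #|e|)%N.
Proof.
move=> eH; have e0 := edge_nonempty eH; have [e1 _] := H_simple _ eH.
have -> : (2 <= #|e|)%N by rewrite ltn_neqAle eq_sym e1 card_gt0.
rewrite andbT !inE; apply/idP/existsP => [/orP[]|[f /and3P[fH fe ef]]].
- move=> /existsP[f /andP[fH /existsP[T /two_partition_proper]]].
  by rewrite properEneq => /andP[ef sef]; exists f; rewrite fH eq_sym ef.
- by case/imsetP=> x _ ex; rewrite ex cards1 in e1.
have /(two_partitionD e0) : e \proper f by rewrite properEneq eq_sym fe.
by move=> /(part_in_index_set _ _ _ fH); rewrite !inE.
Qed.

(** The edges counted by the degree are those strictly containing [S], which give
the row sum of the unified matrix, and possibly [S] itself. *)
Lemma unified_degree_simple S : unified_degree H S =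
  (#|[set e | (e \in edges H) && (S \proper e)]| + (S \in edges H))%N.
Proof.
rewrite /unified_degree (bigD1 S)//= addnC edges_simple; congr (_ + _)%N.
rewrite -sum1_card [LHS](eq_bigr (fun e => if e \in edges H then 1 else 0)%N).
  by rewrite -big_mkcondr; apply: eq_bigl => e; rewrite inE properEneq eq_sym;
    case: (_ \in _); rewrite ?andbF // !andbT andbC.
by move=> e _; rewrite edges_simple; case: (_ \in _).
Qed.

Lemma num_included_simple :
  num_included H = (\sum_(S in index_set H) (S \in edges H))%N.
Proof.
rewrite /num_included big_mkcond [RHS]big_mkcond; apply: eq_bigr => e _.
rewrite edges_simple; case: (boolP (e \in edges H)) => [eH|_].
  by rewrite edge_in_index_set.
by rewrite !if_same.
Qed.

(** The terms [S \in edges H] left over by [unified_degree_simple] add up to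
[num_included H], so that what remains is the number of ones of the matrix. *)
Lemma sum_unified_degree :
  (\sum_(S in index_set H) unified_degree H S)%N =
  (\sum_(S in index_set H) \sum_(T in index_set H)
      [exists e, (e \in edges H) && two_partition e S T] + num_included H)%N.
Proof.
rewrite num_included_simple -big_split; apply: eq_bigr => S SI /=.
rewrite unified_degree_simple -card_partners ?index_set_neq0//; congr (_ + _)%N.
rewrite -sum1_card big_mkcond [RHS]big_mkcond; apply: eq_bigr => T _.
by rewrite inE; case: (T \in _) => //=; case: ifP.
Qed.

End Counting.

(** * The trace and the squared norm of the unified matrix *)

Lemma tr_unified_matrix (R : pzRingType) (V : finType) (H : hypergraph V) :
  \tr (unified_matrix H R) = 0.
Proof.
apply: big1 => i _; rewrite mxE; case: existsP => // -[e /andP[_]].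
by case/and4P=> /negbTE S0 _; rewrite setIid S0.
Qed.

Lemma sum_sqr_unified_matrix (R : pzRingType) (V : finType) (H : hypergraph V) :
  is_simple H ->
  \sum_i \sum_j unified_matrix H R i j ^+ 2 =
    \sum_(S in index_set H) (unified_degree H S)%:R - (num_included H)%:R.
Proof.
move=> Hs; rewrite -natr_sum sum_unified_degree// natrD addrK natr_sum.
rewrite [RHS]big_enum_val; apply: eq_bigr => i _.
rewrite natr_sum [RHS]big_enum_val; apply: eq_bigr => j _.
by rewrite mxE; case: [exists _, _]; rewrite ?expr1n ?expr0n.
Qed.

Theorem theorem9p1 (R : realType) (V : finType) (H : hypergraph V)
    (lambda1 : R) :
  is_simple H ->
  largest_eigenvalue (unified_matrix H R) lambda1 ->
  lambda1 ^+ 2 <=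
    ((e_index H)%:R - 1) / (e_index H)%:R *
    ((\sum_(S in index_set H) (unified_degree H S)%:R) - (num_included H)%:R).
Proof.
move=> Hs [eig _]; rewrite -sum_sqr_unified_matrix//.
by apply: eigenvalue_sqr_le eig; apply: tr_unified_matrix.
Qed.
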